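(* Let $\Theta\subseteq\mathbb{R}$ and suppose the statistical experiment $\mathcal{P}=\{P_\theta:\theta\in\Theta\}$, a family of probability measures on a measurable space $(\mathcal{X},\mathcal{A})$, is differentiable in quadratic mean (DQM) with score function $\Delta_\theta$ at each $\theta\in\Theta$. Let $S$ be a measurable map from $(\mathcal{X},\mathcal{A})$ into a measurable space $(\mathcal{Y},\mathcal{B})$, and let $Q_\theta$ be the distribution of $S$ under $P_\theta$, that is, $Q_\theta(B)=P_\theta(S^{-1}B)$ for $B\in\mathcal{B}$. Then: (i) The statistical experiment $\mathcal{Q}=\{Q_\theta:\theta\in\Theta\}$ is also DQM, with score function $\widetilde{\Delta}_\theta(y)=P_\theta(\Delta_\theta\mid S=y)$ at each $\theta\in\Theta$. (ii) At each fixed $\theta\in\Theta$, Fisher information is preserved (that is, $\mathbb{I}_{\mathcal{P}}(\theta)=\mathbb{I}_{\mathcal{Q}}(\theta)$) if and only if $\Delta_\theta(x)=\widetilde{\Delta}_\theta(S(x))$ for $P_\theta$-almost every $x$.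
   Context: Notation: for a measure $P$ and a function $f$, $Pf$ denotes $\int f\,dP$. Definition (DQM). A family $\mathcal{P}=\{P_\theta:\theta\in\Theta\}$ of probability measures on $(\mathcal{X},\mathcal{A})$, with $\Theta\subseteq\mathbb{R}$, is differentiable in quadratic mean (DQM) at $\theta\in\Theta$ with score function $\Delta_\theta$ (a real-valued measurable function on $\mathcal{X}$) if, for $t$ with $\theta+t\in\Theta$, writing the Lebesgue decomposition of $P_{\theta+t}$ with respect to $P_\theta$ as the sum of a part $P^{\perp}_{t,\theta}$ that is singular with respect to $P_\theta$ and a part $P^{(abs)}_{\theta+t}$ that has density $p_{t,\theta}$ with respect to $P_\theta$: (1) $P^{\perp}_{t,\theta}(\mathcal{X})=o(t^2)$ as $t\to0$; (2) $\Delta_\theta\in\mathcal{L}^2(P_\theta)$; (3) $\sqrt{p_{t,\theta}(x)}=1+\tfrac12 t\,\Delta_\theta(x)+r_{t,\theta}(x)$ with $P_\theta(r_{t,\theta}^2)=o(t^2)$ as $t\to0$. The family is called DQM if it is DQM at each $\theta\in\Theta$. The definition applies in the same way to $\mathcal{Q}$ on $(\mathcal{Y},\mathcal{B})$. $P_\theta(\Delta_\theta\mid S=y)$ is the Kolmogorov conditional expectation: the ($Q_\theta$-almost everywhere unique) $\mathcal{B}$-measurable function $\widetilde{\Delta}_\theta$ on $\mathcal{Y}$ such that $Q_\theta(f\,\widetilde{\Delta}_\theta)=P_\theta\big(f(S(x))\,\Delta_\theta(x)\big)$ for all bounded measurable real $f$ on $\mathcal{Y}$. The Fisher information at $\theta$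 of a DQM experiment is the second moment of its score function: $\mathbb{I}_{\mathcal{P}}(\theta)=P_\theta(\Delta_\theta^2)$ and $\mathbb{I}_{\mathcal{Q}}(\theta)=Q_\theta(\widetilde{\Delta}_\theta^2)$, where $\Delta_\theta$ and $\widetilde{\Delta}_\theta$ are the score functions named in the claim. *)

(* Defs.v *)
From HB Require Import structures.
From mathcomp Require Import all_boot all_order all_algebra.
From mathcomp Require Import all_classical all_reals all_analysis.

Set Implicit Arguments.
Unset Strict Implicit.
Unset Printing Implicit Defensive.

Import Order.TTheory GRing.Theory Num.Theory.
Import numFieldNormedType.Exports.

Local Open Scope classical_set_scope.
Local Open Scope ring_scope.

Definition mutually_singular d (T : measurableType d) (R : realType)
    (mu nu : set T -> \bar R) : Prop :=
  exists N : set T, [/\ measurable N, mu N = 0%E & nu (~` N) = 0%E].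

(* The measure [mu] has Lebesgue decomposition [perp + p . nu] with respect to
   [nu].  For finite [mu] the density may be taken real-valued. *)
Definition lebesgue_decomposition d (T : measurableType d) (R : realType)
    (mu nu perp : {measure set T -> \bar R}) (p : T -> R) : Prop :=
  [/\ mutually_singular perp nu,
      measurable_fun setT p,
      (forall x, 0 <= p x) &
      forall A, measurable A ->
        (mu A = perp A + \int[nu]_(x in A) (p x)%:E)%E].

(* Filter of [t --> 0] restricted to increments with [theta + t] in [Theta].
   The point [t = 0] is kept: there the decomposition is trivial
   ([perp = 0], [p = 1] almost everywhere) and both remainders vanish. *)
Definition increments_to0 (R : realType) (Theta : set R) (theta : R) :
    filter_on R :=
  FilterType (within [set t | Theta (theta + t)] (nbhs 0)) _.

Definition o_square (R : realType) (F : filter_on R) (f : R -> R) : Prop :=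
  (f : R -> R^o) =o_F (fun t => t ^+ 2 : R^o).

(* [P] is a total function, but only its values on [Theta] are used.
   The [fine] and the real-valued integral lose nothing: [perp t] is bounded
   by a probability measure, and the remainder is square integrable because
   [p t] is integrable and the score is in L2. *)
Definition dqm_at d (T : measurableType d) (R : realType) (Theta : set R)
    (P : R -> probability T R) (theta : R) (score : T -> R) : Prop :=
  exists (perp : R -> {measure set T -> \bar R}) (p : R -> T -> R),
    [/\ (forall t, Theta (theta + t) ->
           lebesgue_decomposition (P (theta + t)) (P theta) (perp t) (p t)),
        o_square (increments_to0 Theta theta) (fun t => fine (perp t setT)),
        score \in Lfun (P theta) 2%:E &
        o_square (increments_to0 Theta theta) (fun t => \int[P theta]_x
           (Num.sqrt (p t x) - (1 + 2^-1 * t * score x)) ^+ 2)].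

Definition dqm d (T : measurableType d) (R : realType) (Theta : set R)
    (P : R -> probability T R) (score : R -> T -> R) : Prop :=
  forall theta, Theta theta -> dqm_at Theta P theta (score theta).

(* [g] is a version of [y |-> P(h | S = y)].  Integrability makes the tested
   integrals meaningful; it is implied by the test functions
   [\1_[set y | 0 <= g y]] and [\1_[set y | g y < 0]] when [h] is integrable. *)
Definition is_cond_expectation d d' (X : measurableType d)
    (Y : measurableType d') (R : realType) (P : probability X R)
    (S : {mfun X >-> Y}) (h : X -> R) (g : Y -> R) : Prop :=
  (distribution P S).-integrable setT (EFin \o g) /\
  forall f : Y -> R, measurable_fun setT f -> bounded_fun f ->
    (\int[distribution P S]_y (f y * g y)%:E
       = \int[P]_x (f (S x) * h x)%:E)%E.

Definition fisher_information d (T : measurableType d) (R : realType)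
    (mu : probability T R) (score : T -> R) : \bar R :=
  (\int[mu]_x ((score x) ^+ 2)%:E)%E.

(* Main.v *)
Require Import Defs.
From HB Require Import structures.
From mathcomp Require Import all_boot all_order all_algebra.
From mathcomp Require Import all_classical all_reals all_analysis.
From mathcomp Require Import measurable_realfun ring lra.

(** Fix [theta] and write [P] for [P theta], [Q] for its image under [S], [E]
    for conditional expectation given [S], and [g = E Delta]. The family of
    bounded linear densities [1 + t * h] on [P], with [h] bounded and [t]
    small, is the case where everything is explicit: its image under [S] has
    density [1 + t * E h], with no error term and no singular part. The theorem
    follows by comparing the given family with such a linear one on the space
    [X], and transporting the comparison to [Y], because the Hellinger distance
    does not increase under [S].

    In detail, the score [Delta] is approximated in L2 by a bounded [Delta'],
    up to an error of squared norm at most [e] ([sqr_truncation]). Set [g' = E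
    Delta'], which can be chosen with the same bound as [Delta']
    ([bounded_cond_expectation_exists]). Up to terms that are quadratic in [t],
    uniformly in the sample point, [sqrt (1 + t * a)] is [1 + t * a / 2]
    ([sqrt_linear_approx]). Hence, by the DQM expansion of [P (theta + t)], the
    squared Hellinger distance between its density [p] and [1 + t * Delta'] is
    at most a constant times [e * t ^ 2], plus [o(t ^ 2)]. By
    [hellinger_contraction] the same holds for the density [q] of the image of
    [P (theta + t)] and [1 + t * g'], up to the singular mass, which is [o(t ^
    2)]. Finally [g' - g = E (Delta' - Delta)] is at most as large in L2 as
    [Delta' - Delta], so [sqrt q] is [1 + t * g / 2] up to an error of squared
    norm at most a constant times [e * t ^ 2] for small [t]
    ([score_remainder_le]); and [e] is arbitrary.

    The image of the singular part of [P (theta + t)] need not be singular with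
    respect to [Q]. It is decomposed again, and its absolutely continuous part
    is added to the pushed density ([pushforward_lebesgue_decomposition]). This
    can only decrease the singular mass, and it changes the density by a
    function of integral at most that mass.

    Both the square integrability of [g] and the statement on Fisher
    information come from the Pythagoras inequality
    [P (Delta - g(S)) ^ 2 + P g(S) ^ 2 <= P Delta ^ 2], with [P] also denoting
    the integral ([cond_expectation_pythagoras]): equal Fisher informations
    force the first term to vanish. *)

Set Implicit Arguments.
Unset Strict Implicit.
Unset Printing Implicit Defensive.

Import Order.TTheory GRing.Theory Num.Theory.
Import numFieldNormedType.Exports.

Local Open Scope classical_set_scope.
Local Open Scope ring_scope.

(** * Integration lemmas *)

Lemma bounded_funE (T : Type) (R : realType) (f : T -> R) :
  bounded_fun f <-> exists2 M : R, 0 <= M & forall x, `|f x| <= M.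
Proof.
split=> [[M [_ Mf]]|[M M0 Mf]].
  exists (`|M| + 1) => [|x]; first by rewrite addr_ge0.
  by apply: (Mf (`|M| + 1)) => //; rewrite ltr_pwDr// ler_norm.
exists M; split; first exact: num_real.
by move=> N /ltW MN x _ /=; apply: le_trans (Mf x) MN.
Qed.

Lemma normr_indic_le1 (T : Type) (R : realType) (A : set T) (x : T) :
  `|\1_A x : R| <= 1.
Proof. by rewrite indicE; case: (_ \in _); rewrite ?normr1 ?normr0. Qed.

Lemma integrable_bounded_mul d (T : measurableType d) (R : realType)
    (mu : {measure set T -> \bar R}) (f h : T -> R) (M : R) :
  measurable_fun setT f -> (forall x, `|f x| <= M) ->
  mu.-integrable setT (EFin \o h) ->
  mu.-integrable setT (fun x => (f x * h x)%:E).
Proof.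
move=> mf fM ih.
have bf : bounded_fun f.
  apply/bounded_funE; exists `|M| => // x.
  by apply: le_trans (ler_norm M); exact: fM.
exact: (integrableMr measurableT mf bf ih).
Qed.

Lemma ge0_integrable_fin d (T : measurableType d) (R : realType)
    (mu : {measure set T -> \bar R}) (f : T -> R) :
  measurable_fun setT f -> (forall x, 0 <= f x) ->
  (\int[mu]_x (f x)%:E < +oo)%E -> mu.-integrable setT (EFin \o f).
Proof.
move=> mf f0 foo; apply/integrableP; split; first exact/measurable_EFinP.
rewrite (eq_integral (fun x => (f x)%:E))// => x _.
by rewrite /= ger0_norm.
Qed.

Lemma ge0_integral_eq0_ae d (T : measurableType d) (R : realType)
    (mu : {measure set T -> \bar R}) (D : set T) (f : T -> R) :
  measurable D -> measurable_fun D f -> (forall x, 0 <= f x) ->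
  (\int[mu]_(x in D) (f x)%:E <= 0)%E ->
  {ae mu, forall x, D x -> f x = 0}.
Proof.
move=> mD mf f0 le0.
have mEf : measurable_fun D (EFin \o f) by exact/measurable_EFinP.
have /(ae_eq_integral_abs mu mD mEf) : (\int[mu]_(x in D) `|(f x)%:E| = 0)%E.
  apply/eqP; rewrite eq_le integral_ge0// andbT.
  rewrite (eq_integral (fun x => (f x)%:E))// => x _.
  by rewrite gee0_abs// lee_fin.
by apply: filterS => x fx Dx; have [] := fx Dx.
Qed.

Lemma integral_indic_mul d (T : measurableType d) (R : realType)
    (mu : {measure set T -> \bar R}) (A : set T) (f : T -> R) :
  (\int[mu]_(x in A) (f x)%:E = \int[mu]_x (\1_A x * f x)%:E)%E.
Proof.
rewrite integral_mkcond epatch_indic.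
by apply: eq_integral => x _; rewrite /= -EFinM mulrC.
Qed.

(** Monotone convergence along the sets where [|u| <= n]. On such a set the
    products of [u] with integrable functions are integrable, so that integrals
    can be computed there by linearity before anything is known on [u]. *)
Lemma ge0_integral_le_truncations d (T : measurableType d) (R : realType)
    (mu : {measure set T -> \bar R}) (F u : T -> R) (C : \bar R) :
  measurable_fun setT F -> (forall x, 0 <= F x) -> measurable_fun setT u ->
  (forall n : nat,
    \int[mu]_x (\1_[set y | `|u y| <= n%:R] x * F x)%:E <= C)%E ->
  (\int[mu]_x (F x)%:E <= C)%E.
Proof.
move=> mF F0 mu_ FC.
pose A (n : nat) := [set y | `|u y| <= n%:R].
have mA n : measurable (A n).
  rewrite -[A n]setTI; apply: measurable_fun_ler => //.
  exact: measurableT_comp.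
pose G n x := (\1_(A n) x * F x)%:E.
have limG x : (limn (G ^~ x) = (F x)%:E)%E.
  apply/cvg_lim => //; apply: cvg_near_cst; near=> n.
  rewrite /G indicE mem_set ?mul1r// /A/=.
  by near: n; exact: nbhs_infty_ger.
under eq_integral do rewrite -limG.
have mG n : measurable_fun setT (G n).
  by apply/measurable_EFinP; exact: measurable_funM.
have G0 n x : setT x -> (0 <= G n x)%E by move=> _; rewrite lee_fin mulr_ge0.
have ndG x : setT x -> {homo G ^~ x : n m / (n <= m)%N >-> (n <= m)%E}.
  move=> _ n m nm; rewrite lee_fin ler_wpM2r// !indicE ler_nat.
  have [/[!inE] xA|//] := boolP (x \in A n).
  by rewrite mem_set//= /A/=; apply: le_trans xA _; rewrite ler_nat.
rewrite monotone_convergence//; apply: lime_le; last exact: nearW.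
by apply/cvg_ex; eexists; exact: cvg_monotone_convergence.
Unshelve. all: by end_near. Qed.

(** Cut [h] to [0] where [|h| > n]: the squared error is dominated by [h ^ 2]
    and vanishes at every point for large [n]. *)
Lemma sqr_truncation d (T : measurableType d) (R : realType)
    (mu : {measure set T -> \bar R}) (h : T -> R) (e : R) :
  measurable_fun setT h -> mu.-integrable setT (fun x => (h x ^+ 2)%:E) ->
  0 < e ->
  exists (M : R) (h' : T -> R), [/\ 0 <= M, measurable_fun setT h',
    (forall x, `|h' x| <= M) &
    (\int[mu]_x ((h x - h' x) ^+ 2)%:E <= e%:E)%E].
Proof.
move=> mh ih2 e0.
pose A (n : nat) := [set y | `|h y| <= n%:R].
have mA n : measurable (A n).
  rewrite -[A n]setTI; apply: measurable_fun_ler => //.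
  exact: measurableT_comp.
pose h' n x := \1_(A n) x * h x.
have mh' n : measurable_fun setT (h' n).
  by apply: measurable_funM => //; exact: measurable_indic.
pose F n x := ((h x - h' n x) ^+ 2)%:E.
have mF n : measurable_fun setT (F n).
  by apply/measurable_EFinP; apply: measurable_funX; exact: measurable_funB.
have F0 : {ae mu, forall x, setT x -> F n x @[n --> \oo] --> cst 0%E x}.
  apply: aeW => x _; apply: cvg_near_cst; near=> n.
  rewrite /F /h' indicE mem_set ?mul1r ?subrr ?expr0n// /A/=.
  by near: n; exact: nbhs_infty_ger.
have Fh : {ae mu, forall x n, setT x -> (`|F n x| <= (h x ^+ 2)%:E)%E}.
  apply: aeW => x n _; rewrite gee0_abs ?lee_fin ?sqr_ge0// /h' indicE.
  by case: (_ \in _); rewrite ?mul1r ?mul0r ?subrr ?subr0// expr0n sqr_ge0.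
have [_ _] := dominated_convergence measurableT mF (measurable_cst _) F0 ih2 Fh.
rewrite integral0 => /fine_cvgP[_ /cvgrPdist_lt /(_ e e0)].
move=> [n _ /(_ n (leqnn n))].
rewrite /= sub0r normrN => Fe.
exists n%:R, (h' n); split => //.
  move=> x; rewrite /h' indicE; have [/[!inE] yA|_] := boolP (x \in A n).
    by rewrite mul1r.
  by rewrite mul0r normr0.
have Ffin : (\int[mu]_x F n x)%E \is a fin_num.
  apply: integrable_fin_num => //; apply: le_integrable ih2 => // x _.
  rewrite gee0_abs ?lee_fin ?sqr_ge0//.
  rewrite ger0_norm ?sqr_ge0//  /h' indicE.
  by case: (_ \in _); rewrite ?mul1r ?mul0r ?subrr ?subr0// expr0n sqr_ge0.
rewrite -/(F n) -[leLHS]fineK// lee_fin.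
exact: le_trans (ler_norm _) (ltW Fe).
Unshelve. all: by end_near. Qed.

Lemma measurable_fun_sqrt d (T : measurableType d) (R : realType) (f : T -> R) :
  measurable_fun setT f -> measurable_fun setT (fun x => Num.sqrt (f x)).
Proof.
move=> mf; apply: (measurableT_comp _ mf).
by apply: continuous_measurable_fun; exact: sqrt_continuous.
Qed.

Lemma measurable_fun_inv_ge0 d (T : measurableType d) (R : realType)
    (f : T -> R) :
  measurable_fun setT f -> (forall x, 0 <= f x) ->
  measurable_fun setT (fun x => (f x)^-1).
Proof.
move=> mf f0; rewrite (_ : (fun x => _) = fun x => f x `^ (-1)).
  exact: (measurableT_comp (measurable_powR _) mf).
by apply/funext => x; rewrite powR_inv1.
Qed.

(** The middle term is controlled pointwise: in the applications it is the
    error of a Taylor expansion, which is uniform in [x]. *)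
Lemma ge0_integral_sqr_add3 d (T : measurableType d) (R : realType)
    (mu : probability T R) (u a b c : T -> R) (A C K : R) :
  measurable_fun setT u -> measurable_fun setT a -> measurable_fun setT c ->
  (forall x, u x = a x + b x + c x) -> (forall x, `|b x| <= K) ->
  (\int[mu]_x (a x ^+ 2)%:E <= A%:E)%E ->
  (\int[mu]_x (c x ^+ 2)%:E <= C%:E)%E ->
  (\int[mu]_x (u x ^+ 2)%:E <= (3 * (A + K ^+ 2 + C))%:E)%E.
Proof.
move=> mu_ ma mc uE bK aA cC.
have ma2 : measurable_fun setT (fun x => (a x ^+ 2)%:E).
  by apply/measurable_EFinP; exact: measurable_funX.
have mc2 : measurable_fun setT (fun x => (c x ^+ 2)%:E).
  by apply/measurable_EFinP; exact: measurable_funX.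
have mK : measurable_fun setT (fun=> (K ^+ 2)%:E : \bar R) by [].
apply: (@le_trans _ _
    (\int[mu]_x (3%:E * ((a x ^+ 2)%:E + (K ^+ 2)%:E + (c x ^+ 2)%:E)))%E).
  apply: ge0_le_integral => //.
  - by move=> x _; rewrite lee_fin sqr_ge0.
  - by apply/measurable_EFinP; exact: measurable_funX.
  - by apply: measurable_funeM; do 2 apply: emeasurable_funD => //.
  - move=> x _; rewrite -!EFinD -EFinM lee_fin uE.
    have b2 : b x ^+ 2 <= K ^+ 2.
      by rewrite -real_normK ?num_real// lerXn2r ?nnegrE// (le_trans _ (bK x)).
    have := sqr_ge0 (a x - b x); have := sqr_ge0 (b x - c x).
    by have := sqr_ge0 (c x - a x); nra.
rewrite ge0_integralZl//; last 2 first.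
- by do 2 apply: emeasurable_funD => //.
- by move=> x _; rewrite -!EFinD lee_fin !addr_ge0// sqr_ge0.
rewrite [leRHS]EFinM lee_pmul2l//.
rewrite ge0_integralD//; last 3 first.
- by move=> x _; rewrite -EFinD lee_fin addr_ge0// sqr_ge0.
- exact: emeasurable_funD.
- by move=> x _; rewrite lee_fin sqr_ge0.
rewrite ge0_integralD//; last 2 first.
- by move=> x _; rewrite lee_fin sqr_ge0.
- by move=> x _; rewrite lee_fin sqr_ge0.
rewrite integral_cst// [X in (_ * X)%E]probability_setT mule1 !EFinD.
by rewrite !leeD.
Qed.

Lemma Lfun2_of_sqr_integral d (T : measurableType d) (R : realType)
    (mu : {measure set T -> \bar R}) (f : T -> R) :
  measurable_fun setT f -> (\int[mu]_x (f x ^+ 2)%:E < +oo)%E ->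
  f \in Lfun mu 2%:E.
Proof.
move=> mf foo; rewrite inE; apply/andP; split; rewrite inE//=.
rewrite /finite_norm unlock; apply: poweR_lty.
rewrite (eq_integral (fun x => (f x ^+ 2)%:E))// => x _ /=.
by rewrite powR_mulrn// real_normK ?num_real.
Qed.

(** * Densities, Radon-Nikodym and Lebesgue decomposition *)

(** The hypotheses on [h] are arguments so that the measure structure can be
    attached to this function of sets. *)
Definition density_measure d (T : measurableType d) (R : realType)
    (mu : {measure set T -> \bar R}) (h : T -> R)
    (mh : measurable_fun setT h) (h0 : forall x, 0 <= h x)
    (ih : mu.-integrable setT (EFin \o h)) : set T -> \bar R :=
  fun A => (\int[mu]_(x in A) (h x)%:E)%E.

Section density_measure.
Context d (T : measurableType d) (R : realType).
Variables (mu : {measure set T -> \bar R}) (h : T -> R).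
Hypotheses (mh : measurable_fun setT h) (h0 : forall x, 0 <= h x).
Hypothesis ih : mu.-integrable setT (EFin \o h).
Local Notation nu := (density_measure mh h0 ih).

Let nu0 : nu set0 = 0%E. Proof. exact: integral_set0. Qed.

Let nu_ge0 A : (0 <= nu A)%E.
Proof. by apply: integral_ge0 => x _; rewrite lee_fin. Qed.

Let nu_sigma_additive : semi_sigma_additive nu.
Proof.
apply: semi_sigma_additive_nng_induced; first exact/measurable_EFinP.
by move=> x; rewrite lee_fin.
Qed.

HB.instance Definition _ :=
  isMeasure.Build _ _ _ nu nu0 nu_ge0 nu_sigma_additive.

Let nu_fin : fin_num_fun nu.
Proof.
by move=> A mA; apply: integrable_fin_num => //; exact: integrableS ih.
Qed.

HB.instance Definition _ := @Measure_isFinite.Build _ _ _ nu nu_fin.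

End density_measure.

Lemma ge0_integral_density_measure d (T : measurableType d) (R : realType)
    (mu : {sigma_finite_measure set T -> \bar R}) (h : T -> R)
    (mh : measurable_fun setT h) (h0 : forall x, 0 <= h x)
    (ih : mu.-integrable setT (EFin \o h)) (f : T -> \bar R) :
  measurable_fun setT f -> (forall x, 0 <= f x)%E ->
  (\int[density_measure mh h0 ih]_x f x = \int[mu]_x (f x * (h x)%:E))%E.
Proof.
move=> mf f0.
set nu : {finite_measure set T -> \bar R} := density_measure mh h0 ih.
have numu : nu `<< mu.
  apply/null_content_dominatesP => A mA A0.
  apply: null_set_integral => //.
  by apply/measurable_EFinP; exact: measurable_funTS.
rewrite -(Radon_Nikodym_SigmaFinite.change_of_variables numu)//.
have mRN : measurable_fun setT (Radon_Nikodym_SigmaFinite.f nu mu).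
  exact: measurable_int (Radon_Nikodym_SigmaFinite.f_integrable numu).
apply: ae_eq_integral => //.
- exact: emeasurable_funM.
- by apply: emeasurable_funM => //; exact/measurable_EFinP.
- apply: ae_eqe_mul2l.
  apply: integral_ae_eq => //.
  + exact: Radon_Nikodym_SigmaFinite.f_integrable.
  + exact/measurable_EFinP.
  + by move=> E _ mE; rewrite -Radon_Nikodym_SigmaFinite.f_integral.
Qed.

Lemma radon_nikodym_real d (T : measurableType d) (R : realType)
    (mu : {sigma_finite_measure set T -> \bar R})
    (nu : {measure set T -> \bar R}) :
  (nu setT < +oo)%E -> nu `<< mu ->
  exists f : T -> R, [/\ measurable_fun setT f, (forall x, 0 <= f x),
    mu.-integrable setT (EFin \o f) &
    forall A, measurable A -> (nu A = \int[mu]_(x in A) (f x)%:E)%E].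
Proof.
move=> nuoo numu.
pose nu' : {finite_measure set T -> \bar R} := mfrestr measurableT nuoo.
have nu'E A : nu' A = nu A by rewrite /nu' /= /mfrestr /mrestr setIT.
have nu'mu : nu' `<< mu.
  apply/null_content_dominatesP => A mA A0; rewrite nu'E.
  exact: (null_content_dominatesP _ _).1 numu A mA A0.
have [f [f0 ffin iff fE]] := radon_nikodym_sigma_finite nu'mu.
have finef : EFin \o (fine \o f) = f by apply/funext => x /=; rewrite fineK.
exists (fine \o f); split.
- by apply/measurable_EFinP; rewrite finef; exact: measurable_int iff.
- by move=> x /=; rewrite fine_ge0.
- by rewrite finef.
- move=> A mA; rewrite -nu'E fE//.
  by apply: eq_integral => x _ /=; rewrite fineK.
Qed.

(** If [g] is the density of [mu] with respect to [mu + nu] and [N] is the set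
    where [g = 0], then [mu] does not charge [N], while a [mu]-null set outside
    [N] is [(mu + nu)]-null because [g > 0] there. So [nu] restricted to [N] is
    singular, and [nu] restricted to the complement of [N] has a density. *)
Lemma lebesgue_decomposition_exists d (T : measurableType d) (R : realType)
    (mu : probability T R) (nu : {measure set T -> \bar R}) :
  (nu setT < +oo)%E ->
  exists (perp : {measure set T -> \bar R}) (q : T -> R),
    [/\ lebesgue_decomposition nu mu perp q,
        mu.-integrable setT (EFin \o q) & (perp setT <= nu setT)%E].
Proof.
move=> nuoo.
have oo : (measure_add mu nu setT < +oo)%E.
  by rewrite measure_addE lte_add_pinfty// ltey_eq fin_num_measure.
pose la : {finite_measure set T -> \bar R} := mfrestr measurableT oo.
have laE A : la A = (mu A + nu A)%E.
  by rewrite -measure_addE /la/= /mfrestr/= /mrestr/= setIT.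
have muoo : (mu setT < +oo)%E by rewrite ltey_eq fin_num_measure.
have mula : mu `<< la.
  apply/null_content_dominatesP => A mA laA.
  have /eqP : (mu A + nu A = 0)%E by rewrite -laE.
  by rewrite padde_eq0// => /andP[/eqP].
have [g [mg g0 ig gE]] := radon_nikodym_real muoo mula.
pose N := [set x | g x = 0].
have mN : measurable N.
  rewrite -[N]setTI (_ : N = g @^-1` [set 0])//; exact: mg.
have mCN := measurableC mN.
have muN : mu N = 0%E.
  by rewrite gE//; apply: integral0_eq => x ->.
pose abs : {measure set T -> \bar R} := mrestr nu mCN.
have absoo : (abs setT < +oo)%E.
  apply: le_lt_trans nuoo; rewrite /abs /= /mrestr setTI.
  by apply: le_measure; rewrite ?inE.
have absmu : abs `<< mu.
  apply/null_content_dominatesP => A mA muA.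
  rewrite /abs/= /mrestr.
  have mAN : measurable (A `&` ~` N) by exact: measurableI.
  have mgAN : measurable_fun (A `&` ~` N) g by exact: measurable_funTS.
  have intg : (\int[la]_(x in A `&` ~` N) (g x)%:E <= 0)%E.
    by rewrite -gE// -muA; apply: le_measure; rewrite ?inE.
  have [Z [mZ Z0 AZ]] := ge0_integral_eq0_ae mAN mgAN g0 intg.
  have laAN : la (A `&` ~` N) = 0%E.
    apply: (subset_measure0 mAN mZ _ Z0) => x [Ax Nx]; apply: AZ => /=.
    by move/(_ (conj Ax Nx)) => /Nx.
  apply/eqP; move/eqP : laAN; rewrite laE padde_eq0//.
  by move=> /andP[].
have [q [mq q0 iq qE]] := radon_nikodym_real absoo absmu.
exists (mrestr nu mN), q; split => //.
- split => //.
  + exists (~` N); split => //=; last by rewrite setCK.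
    by rewrite /mrestr setICl measure0.
  + move=> A mA; rewrite -qE//= /abs/= /mrestr.
    rewrite -measureU//; last by rewrite setIACA setICr setI0.
    + by rewrite -setIUr setUCr setIT.
    + exact: measurableI.
    + exact: measurableI.
- by rewrite /= /mrestr setTI le_measure ?inE.
Qed.

Lemma lebesgue_decomposition_probability d (T : measurableType d) (R : realType)
    (mu nu : probability T R) (perp : {measure set T -> \bar R}) (p : T -> R) :
  lebesgue_decomposition nu mu perp p ->
  (perp setT + \int[mu]_x (p x)%:E = 1)%E /\ mu.-integrable setT (EFin \o p).
Proof.
move=> [_ mp p0 nuE].
have nuT : (perp setT + \int[mu]_x (p x)%:E = 1)%E.
  by rewrite -nuE//; exact: probability_setT.
split => //; apply: ge0_integrable_fin => //.
by apply: (@le_lt_trans _ _ 1%E); rewrite ?ltry// -nuT leeDr.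
Qed.

(** * Pushing densities forward and conditional expectations *)

(** The image under [S] of the measure of density [h] with respect to [P] has
    density [g] with respect to the image of [P]. For nonnegative functions
    this is conditional expectation, tested against all nonnegative functions
    and not only against the bounded ones: the test functions of the Hellinger
    inequality below are unbounded. *)
Definition pushes_density d d' (X : measurableType d) (Y : measurableType d')
    (R : realType) (P : probability X R) (S : {mfun X >-> Y})
    (h : X -> R) (g : Y -> R) : Prop :=
  forall f : Y -> R, measurable_fun setT f -> (forall y, 0 <= f y) ->
  (\int[distribution P S]_y (f y * g y)%:E = \int[P]_x (f (S x) * h x)%:E)%E.

Section push.
Context d d' (X : measurableType d) (Y : measurableType d') (R : realType).
Variables (P : probability X R) (S : {mfun X >-> Y}).
Local Notation Q := (distribution P S).

(** Both integrals are integrals of [f] for one measure on [Y], since the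
    assumption says that two measures on [Y] coincide. *)
Lemma pushes_density_sets (h : X -> R) (g : Y -> R) :
  measurable_fun setT h -> (forall x, 0 <= h x) ->
  measurable_fun setT g -> (forall y, 0 <= g y) ->
  P.-integrable setT (EFin \o h) -> Q.-integrable setT (EFin \o g) ->
  (forall B, measurable B ->
    \int[Q]_(y in B) (g y)%:E = \int[P]_(x in S @^-1` B) (h x)%:E)%E ->
  pushes_density P S h g.
Proof.
move=> mh h0 mg g0 ih ig hg f mf f0.
have mEf : measurable_fun setT (EFin \o f) by exact/measurable_EFinP.
under eq_integral do rewrite EFinM.
under [RHS]eq_integral do rewrite EFinM.
rewrite -(ge0_integral_density_measure mg g0 ig mEf); last first.
  by move=> y; rewrite lee_fin.
rewrite -(ge0_integral_density_measure mh h0 ih (f := EFin \o (f \o S)));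
  last 2 first.
- by apply/measurable_EFinP; exact: measurableT_comp.
- by move=> y; rewrite /= lee_fin.
rewrite [RHS](_ : _ =
  \int[pushforward (density_measure mh h0 ih) S]_y (f y)%:E)%E.
  by apply: eq_measure_integral => B mB _; exact: hg.
by rewrite ge0_integral_pushforward// => y _; rewrite lee_fin.
Qed.

Lemma pushes_density_exists (h : X -> R) :
  (forall x, 0 <= h x) -> P.-integrable setT (EFin \o h) ->
  exists g : Y -> R, [/\ measurable_fun setT g, (forall y, 0 <= g y),
    Q.-integrable setT (EFin \o g) & pushes_density P S h g].
Proof.
move=> h0 ih.
have mh : measurable_fun setT h by exact/measurable_EFinP/(measurable_int P).
pose pushed : {measure set Y -> \bar R} :=
  pushforward (density_measure mh h0 ih) S.
pose nu := pushed (measurable_funPT S).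
have nuQ : nu `<< Q.
  apply/null_content_dominatesP => A mA A0.
  apply: null_set_integral => //.
    by rewrite -[X in measurable X]setTI; apply: measurable_funP.
  by apply/measurable_EFinP; exact: measurable_funTS.
have nuoo : (nu setT < +oo)%E.
  by rewrite /nu/= /pushforward preimage_setT; exact: integrable_lty.
have [g [mg g0 ig gE]] := radon_nikodym_real nuoo nuQ.
exists g; split => //; apply: pushes_density_sets => // B mB.
by rewrite -gE.
Qed.

End push.

Section cond_expectation.
Context d d' (X : measurableType d) (Y : measurableType d') (R : realType).
Variables (P : probability X R) (S : {mfun X >-> Y}).
Local Notation Q := (distribution P S).

(** A bounded test function is the difference of two nonnegative ones, itself
    plus a constant and that constant. *)
Lemma pushes_density_cond_expectation (h : X -> R) (g : Y -> R) :
  P.-integrable setT (EFin \o h) -> Q.-integrable setT (EFin \o g) ->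
  pushes_density P S h g -> is_cond_expectation P S h g.
Proof.
move=> ih ig hg; split => // f mf /bounded_funE[M M0 fM].
have mfS : measurable_fun setT (f \o S) by exact: measurableT_comp.
have fM0 y : 0 <= f y + M.
  by have := fM y; rewrite ler_norml => /andP[+ _]; lra.
have := hg _ (measurable_funD mf (measurable_cst M)) fM0.
have := hg _ (measurable_cst M) (fun=> M0).
have ifg := integrable_bounded_mul mf fM ig.
have ifh : P.-integrable setT (fun x => (f (S x) * h x)%:E).
  exact: (integrable_bounded_mul mfS (fun x => fM (S x)) ih).
have iMg : Q.-integrable setT (fun y => (M * g y)%:E).
  exact: (integrableZl measurableT M ig).
have iMh : P.-integrable setT (fun x => (M * h x)%:E).
  exact: (integrableZl measurableT M ih).
under [X in _ -> X = _ -> _]eq_integral do rewrite /= mulrDl EFinD.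
under [X in _ -> _ = X -> _]eq_integral do rewrite /= mulrDl EFinD.
move=> MM; rewrite integralD// integralD// MM.
move=> /(congr1 (fun z => z - \int[P]_x (M * h x)%:E)%E).
by rewrite !addeK// integrable_fin_num.
Qed.

Lemma is_cond_expectationB (h1 h2 : X -> R) (g1 g2 : Y -> R) :
  P.-integrable setT (EFin \o h1) -> P.-integrable setT (EFin \o h2) ->
  is_cond_expectation P S h1 g1 -> is_cond_expectation P S h2 g2 ->
  is_cond_expectation P S (h1 \- h2) (g1 \- g2).
Proof.
move=> ih1 ih2 [ig1 hg1] [ig2 hg2]; split; first exact: (integrableB _ ig1 ig2).
move=> f mf bf; have /bounded_funE[M M0 fM] := bf.
have mfS : measurable_fun setT (f \o S) by exact: measurableT_comp.
have fSM x : `|(f \o S) x| <= M by exact: fM.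
under eq_integral do rewrite /= mulrBr EFinB.
under [RHS]eq_integral do rewrite /= mulrBr EFinB.
rewrite integralB//; [|exact: (integrable_bounded_mul mf fM)..].
rewrite integralB//; [|exact: (integrable_bounded_mul mfS fSM)..].
by rewrite hg1// hg2.
Qed.

Lemma cond_expectation_exists (h : X -> R) : P.-integrable setT (EFin \o h) ->
  exists g : Y -> R, is_cond_expectation P S h g.
Proof.
move=> ih.
have iabs : P.-integrable setT (EFin \o (Num.norm \o h)).
  exact: integrable_norm.
have isum : P.-integrable setT (EFin \o ((Num.norm \o h) \+ h)).
  exact: (integrableD _ iabs ih).
have sum0 x : 0 <= ((Num.norm \o h) \+ h) x.
  by rewrite /= -lerBlDr sub0r ler_normr lexx orbT.
have abs0 x : 0 <= (Num.norm \o h) x by exact: normr_ge0.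
have [g1 [_ _ ig1 hg1]] := pushes_density_exists S abs0 iabs.
have [g2 [_ _ ig2 hg2]] := pushes_density_exists S sum0 isum.
exists (g2 \- g1).
have -> : h = ((Num.norm \o h) \+ h) \- (Num.norm \o h).
  by apply/funext => x /=; rewrite addrAC subrr add0r.
by apply: is_cond_expectationB => //; exact: pushes_density_cond_expectation.
Qed.

Lemma cond_expectation_measurable (h : X -> R) (g : Y -> R) :
  is_cond_expectation P S h g -> measurable_fun setT g.
Proof. by move=> [/(measurable_int Q) /measurable_EFinP]. Qed.

(** Test against the indicator of the set where [g > M]: there [g - M] is
    positive, but its integral is that of [h - M] over the preimage. *)
Lemma cond_expectation_le (h : X -> R) (g : Y -> R) (M : R) :
  P.-integrable setT (EFin \o h) -> is_cond_expectation P S h g ->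
  (forall x, h x <= M) -> {ae Q, forall y, g y <= M}.
Proof.
move=> ih hg hM; have mg := cond_expectation_measurable hg.
case: hg => ig hg.
pose B := [set y | M < g y].
have mB : measurable B by rewrite -[B]setTI; exact: measurable_fun_ltr.
have B1 y : `|(\1_B : Y -> R) y| <= 1 by exact: normr_indic_le1.
have b1 : bounded_fun (\1_B : Y -> R) by apply/bounded_funE; exists 1.
have m1 : measurable_fun setT (\1_B : Y -> R) by exact: measurable_indic.
have m1S : measurable_fun setT ((\1_B : Y -> R) \o S).
  exact: measurableT_comp.
have B1S x : `|((\1_B : Y -> R) \o S) x| <= 1 by exact: B1.
have icst (T : measurableType _) (mu : probability T R) :
    mu.-integrable setT (EFin \o cst M).
  exact: finite_measure_integrable_cst.
have i1g := integrable_bounded_mul m1 B1 ig.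
have i1M := integrable_bounded_mul m1 B1 (icst _ _ Q).
have i1h := integrable_bounded_mul m1S B1S ih.
have i1MS := integrable_bounded_mul m1S B1S (icst _ _ P).
have le0 : (\int[Q]_y (\1_B y * (g y - M))%:E <= 0)%E.
  under eq_integral do rewrite /= mulrBr EFinB.
  rewrite integralB// sube_le0 hg//.
  rewrite integral_distribution//; last exact: measurable_int i1M.
  apply: le_integral => // x _; rewrite lee_fin ler_wpM2l//.
have ge0 y : 0 <= (\1_B y * (g y - M) : R).
  rewrite indicE; have [/[!inE] yB|_] := boolP (y \in B); last by rewrite mul0r.
  by rewrite mul1r subr_ge0 ltW.
have mf : measurable_fun setT (fun y => \1_B y * (g y - M)).
  by apply: measurable_funM => //; exact: measurable_funB.
have := ge0_integral_eq0_ae measurableT mf ge0 le0.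
apply: filterS => y /(_ I); rewrite indicE.
have [/[!inE] yB|] := boolP (y \in B).
  by rewrite mul1r => /eqP; rewrite subr_eq0 => /eqP ->.
by rewrite notin_setE /B/= => /negP; rewrite -leNgt.
Qed.

Lemma is_cond_expectation_ae_eq (h : X -> R) (g g' : Y -> R) :
  measurable_fun setT g' -> {ae Q, forall y, g y = g' y} ->
  is_cond_expectation P S h g -> is_cond_expectation P S h g'.
Proof.
move=> mg' gg' hg; have mg := cond_expectation_measurable hg.
case: hg => ig hg; split.
  apply/integrableP; split; first exact/measurable_EFinP.
  case/integrableP : ig => _; apply: le_lt_trans.
  rewrite le_eqVlt; apply/orP; left; apply/eqP.
  apply: ae_eq_integral => //.
  - by apply: measurableT_comp => //; exact/measurable_EFinP.
  - by apply: measurableT_comp => //; exact/measurable_EFinP.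
  - by apply: filterS gg' => y /= -> _.
move=> f mf bf; rewrite -hg//; apply: ae_eq_integral => //.
- by apply/measurable_EFinP; exact: measurable_funM.
- by apply/measurable_EFinP; exact: measurable_funM.
- by apply: filterS gg' => y /= -> _.
Qed.

(** A version of the conditional expectation lies in [-M, M] almost everywhere;
    clipping it yields the bound everywhere. *)
Lemma bounded_cond_expectation_exists (h : X -> R) (M : R) :
  0 <= M -> measurable_fun setT h -> (forall x, `|h x| <= M) ->
  exists2 g : Y -> R, is_cond_expectation P S h g & forall y, `|g y| <= M.
Proof.
move=> M0 mh hM.
have ih : P.-integrable setT (EFin \o h).
  apply: measurable_bounded_integrable => //.
    by rewrite ltey_eq fin_num_measure.
  by apply/bounded_funE; exists M.
have [g hg] := cond_expectation_exists ih.
have mg := cond_expectation_measurable hg.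
have gM : {ae Q, forall y, g y <= M}.
  apply: (cond_expectation_le ih hg) => x.
  exact: le_trans (ler_norm _) (hM x).
have gNM : {ae Q, forall y, - g y <= M}.
  have i0 : P.-integrable setT (EFin \o cst (0 : R)) by exact: integrable0.
  have h0 : is_cond_expectation P S (cst 0) (cst 0).
    split; first exact: integrable0.
    move=> f mf bf.
    under eq_integral do rewrite mulr0.
    by under [RHS]eq_integral do rewrite mulr0; rewrite !integral0.
  have hN := is_cond_expectationB i0 ih h0 hg.
  have H : {ae Q, forall y, (cst 0 \- g) y <= M}.
    apply: (cond_expectation_le (integrableB measurableT i0 ih) hN) => x /=.
    by rewrite sub0r; apply: le_trans (ler_norm _) _; rewrite normrN.
  by apply: filterS H => y /=; rewrite sub0r.
exists (fun y => Num.max (- M) (Num.min (g y) M)).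
  apply: (is_cond_expectation_ae_eq _ _ hg).
    by apply: measurable_maxr => //; exact: measurable_minr.
  apply: filterS2 gM gNM => y gy gNy.
  by rewrite (min_idPl gy) (max_idPr _)// lerNl.
move=> y; rewrite ler_norml le_max lexx/= ge_max ge_min lexx orbT andbT.
lra.
Qed.

Lemma cond_expectation_pushes_density (h : X -> R) (g : Y -> R) :
  P.-integrable setT (EFin \o h) ->
  (forall x, 0 <= h x) -> (forall y, 0 <= g y) ->
  is_cond_expectation P S h g -> pushes_density P S h g.
Proof.
move=> ih h0 g0 hg; have mg := cond_expectation_measurable hg.
have mh : measurable_fun setT h by exact/measurable_EFinP/(measurable_int P).
case: hg => ig hg; apply: pushes_density_sets => // B mB.
rewrite integral_indic_mul [RHS]integral_indic_mul hg//.
by apply/bounded_funE; exists 1 => // y; exact: normr_indic_le1.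
Qed.

Lemma is_cond_expectation_affine (h : X -> R) (g : Y -> R) (t : R) :
  P.-integrable setT (EFin \o h) -> is_cond_expectation P S h g ->
  is_cond_expectation P S (fun x => 1 + t * h x) (fun y => 1 + t * g y).
Proof.
move=> ih [ig hg].
have icst (T : measurableType _) (mu : probability T R) :
    mu.-integrable setT (EFin \o cst 1).
  exact: finite_measure_integrable_cst.
split; first exact: (integrableD _ (icst _ _ Q) (integrableZl _ t ig)).
move=> f mf bf; have /bounded_funE[M M0 fM] := bf.
have mfS : measurable_fun setT (f \o S) by exact: measurableT_comp.
have fSM x : `|(f \o S) x| <= M by exact: fM.
have if1 := integrable_bounded_mul mf fM (icst _ _ Q).
have if1S := integrable_bounded_mul mfS fSM (icst _ _ P).
have ifg := integrable_bounded_mul mf fM ig.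
have ifh := integrable_bounded_mul mfS fSM ih.
rewrite (eq_integral (fun y =>
    (f y * cst 1 y)%:E + t%:E * (f y * g y)%:E)%E); last first.
  by move=> y _; rewrite -EFinM -EFinD; congr EFin => /=; ring.
rewrite [RHS](eq_integral (fun x => ((f \o S) x * cst 1 x)%:E +
    t%:E * ((f \o S) x * h x)%:E)%E); last first.
  by move=> y _; rewrite -EFinM -EFinD; congr EFin => /=; ring.
rewrite integralD//; last exact: integrableZl.
rewrite integralD//; last exact: integrableZl.
rewrite integralZl// integralZl// hg//; congr (_ + _)%E.
by rewrite integral_distribution//; exact: measurable_int if1.
Qed.

End cond_expectation.

(** * Conditional expectation in L2 *)

Section cond_expectation_l2.
Context d d' (X : measurableType d) (Y : measurableType d') (R : realType).
Variables (P : probability X R) (S : {mfun X >-> Y}).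
Local Notation Q := (distribution P S).

(** This is an equality in fact: [h - g(S)] is orthogonal to [g(S)]. Testing
    the conditional expectation against [g] would need that [g] is bounded, so
    [g] is tested on the sets where [|g| <= n]; the inequality survives in the
    limit and gives the square integrability of [g] as well. *)
Lemma cond_expectation_pythagoras (h : X -> R) (g : Y -> R) :
  P.-integrable setT (EFin \o h) ->
  P.-integrable setT (fun x => (h x ^+ 2)%:E) ->
  is_cond_expectation P S h g ->
  (\int[P]_x ((h x - g (S x)) ^+ 2 + g (S x) ^+ 2)%:E
     <= \int[P]_x (h x ^+ 2)%:E)%E.
Proof.
move=> ih ih2 hg; have mg := cond_expectation_measurable hg.
have mh : measurable_fun setT h by exact/measurable_EFinP/(measurable_int P).
have mgS : measurable_fun setT (g \o S) by exact: measurableT_comp.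
case: hg => ig hg.
apply: (@ge0_integral_le_truncations _ _ _ _ _ (g \o S)) => //.
- apply: measurable_funD; last exact: measurable_funX.
  by apply: measurable_funX; exact: measurable_funB.
- by move=> x; rewrite addr_ge0// sqr_ge0.
move=> n; pose A := [set y | `|g y| <= n%:R].
have mA : measurable A.
  rewrite -[A]setTI; apply: measurable_fun_ler => //.
  exact: measurableT_comp.
(* On [A] the cross term vanishes, by the choice of [f] as test function. *)
pose f y := \1_A y * g y.
have mf : measurable_fun setT f.
  by apply: measurable_funM => //; exact: measurable_indic.
have fn y : `|f y| <= n%:R.
  rewrite /f indicE; have [/[!inE] yA|_] := boolP (y \in A).
    by rewrite mul1r.
  by rewrite mul0r normr0.
have mfS : measurable_fun setT (f \o S) by exact: measurableT_comp.
have fnS x : `|(f \o S) x| <= n%:R by exact: fn.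
pose one x : R := \1_A (S x).
have m1 : measurable_fun setT one.
  exact: (measurableT_comp (f := \1_A : Y -> R)).
have b1 x : `|one x| <= 1 by exact: normr_indic_le1.
have igS : P.-integrable setT (EFin \o (g \o S)).
  apply/integrableP; split; first exact/measurable_EFinP.
  case/integrableP : ig => _; rewrite ge0_integral_distribution//.
  by apply: measurableT_comp => //; exact/measurable_EFinP.
have i1 := integrable_bounded_mul m1 b1 ih2.
have i2 := integrable_bounded_mul mfS fnS igS.
have i3 := integrable_bounded_mul mfS fnS ih.
rewrite (eq_integral (fun x => (one x * h x ^+ 2)%:E +
    2%:E * (((f \o S) x * (g \o S) x)%:E - ((f \o S) x * h x)%:E))%E);
  last first.
  move=> x _; rewrite -EFinB -EFinM -EFinD; congr EFin.
  have -> : \1_[set y | `|(g \o S) y| <= n%:R] x = one x by [].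
  by rewrite /= /f -/(one x); ring.
rewrite integralD//; last exact/(integrableZl _ _ (integrableB _ i2 i3)).
rewrite integralZl//; last exact: integrableB.
rewrite integralB//.
have -> : (\int[P]_x ((f \o S) x * (g \o S) x)%:E =
           \int[P]_x ((f \o S) x * h x)%:E)%E.
  rewrite -(hg f mf); last by apply/bounded_funE; exists n%:R.
  rewrite integral_distribution//.
  by apply/measurable_EFinP; exact: measurable_funM.
rewrite subee ?mule0 ?adde0; last exact: integrable_fin_num.
apply: le_integral => // x _; rewrite lee_fin ler_piMl ?sqr_ge0//.
exact: le_trans (ler_norm _) (b1 x).
Qed.

Lemma cond_expectation_contraction (h : X -> R) (g : Y -> R) :
  P.-integrable setT (EFin \o h) ->
  P.-integrable setT (fun x => (h x ^+ 2)%:E) ->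
  is_cond_expectation P S h g ->
  (\int[Q]_y (g y ^+ 2)%:E <= \int[P]_x (h x ^+ 2)%:E)%E.
Proof.
move=> ih ih2 hg; have mg := cond_expectation_measurable hg.
have mh : measurable_fun setT h by exact/measurable_EFinP/(measurable_int P).
have mg2 : measurable_fun setT (fun y => (g y ^+ 2)%:E).
  by apply/measurable_EFinP; exact: measurable_funX.
apply: le_trans (cond_expectation_pythagoras ih ih2 hg).
rewrite ge0_integral_distribution//; last by move=> y; rewrite lee_fin sqr_ge0.
have mgS : measurable_fun setT (g \o S) by exact: measurableT_comp.
apply: ge0_le_integral => //.
- by move=> x _; rewrite lee_fin sqr_ge0.
- exact: measurableT_comp.
- apply/measurable_EFinP; apply: measurable_funD; last exact: measurable_funX.
  by apply: measurable_funX; exact: measurable_funB.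
- by move=> x _; rewrite lee_fin lerDr sqr_ge0.
Qed.

Lemma fisher_information_preserved (h : X -> R) (g : Y -> R) :
  P.-integrable setT (EFin \o h) ->
  P.-integrable setT (fun x => (h x ^+ 2)%:E) ->
  is_cond_expectation P S h g ->
  fisher_information P h = fisher_information Q g <->
  {ae P, forall x, h x = g (S x)}.
Proof.
move=> ih ih2 hg; have mg := cond_expectation_measurable hg.
have mh : measurable_fun setT h by exact/measurable_EFinP/(measurable_int P).
have mgS : measurable_fun setT (g \o S) by exact: measurableT_comp.
have mg2 : measurable_fun setT (fun y => (g y ^+ 2)%:E).
  by apply/measurable_EFinP; exact: measurable_funX.
have mgS2 : measurable_fun setT (fun x => (g (S x) ^+ 2)%:E).
  exact: (measurableT_comp mg2).
have mD : measurable_fun setT (fun x => (h x - g (S x)) ^+ 2).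
  by apply: measurable_funX; exact: measurable_funB.
have QE : fisher_information Q g = (\int[P]_x (g (S x) ^+ 2)%:E)%E.
  rewrite /fisher_information ge0_integral_distribution// => y.
  by rewrite lee_fin sqr_ge0.
have mED : measurable_fun setT (fun x => ((h x - g (S x)) ^+ 2)%:E).
  exact/measurable_EFinP.
rewrite QE /fisher_information; split=> [hE|hgS].
- have := cond_expectation_pythagoras ih ih2 hg.
  under eq_integral do rewrite EFinD.
  rewrite ge0_integralD//; [|by move=> x _; rewrite lee_fin sqr_ge0..].
  have gfin : (\int[P]_x (g (S x) ^+ 2)%:E)%E \is a fin_num.
    by rewrite -hE; exact: integrable_fin_num.
  rewrite hE -leeBrDr// subee//.
  move/(ge0_integral_eq0_ae measurableT mD (fun=> sqr_ge0 _)).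
  apply: filterS => x /(_ I)/eqP.
  by rewrite expf_eq0/= subr_eq0 => /eqP.
- apply: ae_eq_integral => //.
    by apply/measurable_EFinP; exact: measurable_funX.
  by apply: filterS hgS => x /= -> _.
Qed.

End cond_expectation_l2.

(** * Contraction of the Hellinger distance *)

Lemma hellinger_sqr_expand d (T : measurableType d) (R : realType)
    (mu : {measure set T -> \bar R}) (a b : T -> R) :
  measurable_fun setT a -> (forall x, 0 <= a x) ->
  measurable_fun setT b -> (forall x, 0 <= b x) ->
  (\int[mu]_x ((Num.sqrt (a x) - Num.sqrt (b x)) ^+ 2)%:E +
   2%:E * \int[mu]_x (Num.sqrt (a x) * Num.sqrt (b x))%:E =
   \int[mu]_x (a x)%:E + \int[mu]_x (b x)%:E)%E.
Proof.
move=> ma a0 mb b0.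
have msa := measurable_fun_sqrt ma; have msb := measurable_fun_sqrt mb.
have msab : measurable_fun setT (fun x => (Num.sqrt (a x) * Num.sqrt (b x))%:E).
  by apply/measurable_EFinP; exact: measurable_funM.
have ab0 x : setT x -> (0 <= (Num.sqrt (a x) * Num.sqrt (b x))%:E)%E.
  by move=> _; rewrite lee_fin mulr_ge0// sqrtr_ge0.
have d0 x : setT x -> (0 <= ((Num.sqrt (a x) - Num.sqrt (b x)) ^+ 2)%:E)%E.
  by move=> _; rewrite lee_fin sqr_ge0.
have md : measurable_fun setT
    (fun x => ((Num.sqrt (a x) - Num.sqrt (b x)) ^+ 2)%:E).
  by apply/measurable_EFinP; apply: measurable_funX; exact: measurable_funB.
have mEa : measurable_fun setT (fun x => (a x)%:E) by exact/measurable_EFinP.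
have mEb : measurable_fun setT (fun x => (b x)%:E) by exact/measurable_EFinP.
rewrite -ge0_integralZl_EFin// -ge0_integralD//; last first.
  exact: measurable_funeM.
rewrite -ge0_integralD//; last 2 first.
- by move=> x _; rewrite lee_fin.
- by move=> x _; rewrite lee_fin.
apply: eq_integral => x _; rewrite -EFinM -!EFinD; congr EFin.
by rewrite -[in RHS](sqr_sqrtr (a0 x)) -[in RHS](sqr_sqrtr (b0 x)); ring.
Qed.

Section hellinger.
Context d d' (X : measurableType d) (Y : measurableType d') (R : realType).
Variables (P : probability X R) (S : {mfun X >-> Y}).
Local Notation Q := (distribution P S).

(** For every positive function [phi] on [Y], the arithmetic-geometric mean
    inequality gives [2 sqrt (p h) <= phi(S) p + h / phi(S)], and the integral
    of the right-hand side is the integral of [phi q0 + k / phi] over [Y], hence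
    at most that of [phi q + k / phi]. For [phi = sqrt (k / q)] the latter is
    twice the affinity of [q] and [k]. *)
Lemma hellinger_affinity_le (p h : X -> R) (q0 q k : Y -> R) :
  measurable_fun setT p -> (forall x, 0 <= p x) ->
  measurable_fun setT h -> (forall x, 0 <= h x) ->
  measurable_fun setT q0 -> measurable_fun setT q ->
  (forall y, 0 <= q0 y) -> (forall y, q0 y <= q y) ->
  (forall y, 0 < k y) -> Q.-integrable setT (EFin \o k) ->
  pushes_density P S p q0 -> pushes_density P S h k ->
  (\int[P]_x (Num.sqrt (p x) * Num.sqrt (h x))%:E <=
   \int[Q]_y (Num.sqrt (q y) * Num.sqrt (k y))%:E)%E.
Proof.
move=> mp p0 mh h0 mq0 mq q00 q0q k0 ik pq hk.
have mk : measurable_fun setT k by exact/measurable_EFinP/(measurable_int Q).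
have msp := measurable_fun_sqrt mp; have msh := measurable_fun_sqrt mh.
have msq := measurable_fun_sqrt mq; have msk := measurable_fun_sqrt mk.
have sk0 y : 0 < Num.sqrt (k y) by rewrite sqrtr_gt0.
set A := (\int[P]_x _)%E; set B := (\int[Q]_x _)%E.
pose K : R := fine (\int[Q]_y (Num.sqrt (k y))%:E)%E.
have KE : (\int[Q]_y (Num.sqrt (k y))%:E)%E = K%:E.
  rewrite fineK// integrable_fin_num//.
  apply: (@le_integrable _ _ _ _ _ measurableT _ (EFin \o (cst 1 \+ k))).
  - exact/measurable_EFinP.
  - move=> y _; rewrite lee_fin ger0_norm ?sqrtr_ge0//= ger0_norm; last first.
      by rewrite addr_ge0// ltW.
    have := sqr_sqrtr (ltW (k0 y)); have := sqr_ge0 (Num.sqrt (k y) - 1).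
    by have := sk0 y; nra.
  - exact: (integrableD measurableT
      (finite_measure_integrable_cst Q 1 measurableT) ik).
have K0 : 0 <= K.
  by apply: fine_ge0; apply: integral_ge0 => y _; rewrite lee_fin sqrtr_ge0.
suff H (e : R) : 0 < e -> (2%:E * A <= 2%:E * B + (e * K)%:E)%E.
  rewrite -(@lee_pmul2l _ 2%:E)//; apply/lee_addgt0Pr => e e0.
  have K1 : 0 < K + 1 by rewrite ltr_wpDl.
  apply: le_trans (H (e / (K + 1)) (divr_gt0 e0 K1)) _.
  by rewrite leeD2l// lee_fin mulrAC ler_pdivrMr// ler_pM2l// lerDl.
move=> e0.
(* Adding [e] keeps [phi = sqrt k / sqrt q] finite where [q] vanishes. *)
pose r y := Num.sqrt (q y) + e.
have r0 y : 0 < r y by rewrite ltr_wpDl// sqrtr_ge0.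
have mr : measurable_fun setT r by apply: measurable_funD.
pose phi y := Num.sqrt (k y) / r y.
pose psi y := r y / Num.sqrt (k y).
have phi0 y : 0 <= phi y by rewrite divr_ge0// ltW.
have psi0 y : 0 <= psi y by rewrite divr_ge0// ltW.
have mphi : measurable_fun setT phi.
  apply: measurable_funM => //; apply: measurable_fun_inv_ge0 => // y.
  exact: ltW.
have mpsi : measurable_fun setT psi.
  apply: measurable_funM => //; apply: measurable_fun_inv_ge0 => // y.
have mphiS : measurable_fun setT (phi \o S) by exact: measurableT_comp.
have mpsiS : measurable_fun setT (psi \o S) by exact: measurableT_comp.
have amgm x : 2 * (Num.sqrt (p x) * Num.sqrt (h x)) <=
    phi (S x) * p x + psi (S x) * h x.
  rewrite /phi /psi; move: (sk0 (S x)) (r0 (S x)).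
  move: (sqr_sqrtr (p0 x)) (sqr_sqrtr (h0 x)).
  set a := Num.sqrt (p x); set b := Num.sqrt (h x).
  set s := Num.sqrt _; set u := r _ => <- <- s0 u0.
  rewrite -subr_ge0 (_ : _ - _ = (s * a - u * b) ^+ 2 / (s * u)).
    by rewrite divr_ge0 ?sqr_ge0// mulr_ge0// ltW.
  by field; rewrite !gt_eqF.
have -> : (2%:E * A = \int[P]_x (2 * (Num.sqrt (p x) * Num.sqrt (h x)))%:E)%E.
  under eq_integral do rewrite EFinM.
  rewrite ge0_integralZl_EFin//.
  by apply/measurable_EFinP; exact: measurable_funM.
apply: (@le_trans _ _ (\int[P]_x (phi (S x) * p x + psi (S x) * h x)%:E)%E).
  apply: ge0_le_integral => //.
  - apply/measurable_EFinP; apply: measurable_funM => //.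
    exact: measurable_funM.
  - by apply/measurable_EFinP; apply: measurable_funD; apply: measurable_funM.
  - by move=> x _; rewrite lee_fin.
under eq_integral do rewrite EFinD.
rewrite ge0_integralD//; last 4 first.
- by move=> x _; rewrite lee_fin mulr_ge0.
- by apply/measurable_EFinP; exact: measurable_funM.
- by move=> x _; rewrite lee_fin mulr_ge0.
- by apply/measurable_EFinP; exact: measurable_funM.
rewrite -(pq _ mphi phi0) -(hk _ mpsi psi0).
have -> : (\int[Q]_y (psi y * k y)%:E = B + (e * K)%:E)%E.
  rewrite EFinM -KE -ge0_integralZl_EFin//; last 2 first.
  - exact/measurable_EFinP.
  - exact: ltW.
  rewrite -ge0_integralD//; last 3 first.
  - by apply/measurable_EFinP; exact: measurable_funM.
  - by move=> y _; rewrite -EFinM lee_fin mulr_ge0// ltW.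
  - by apply/measurable_EFinP; exact: measurable_funM.
  apply: eq_integral => y _; rewrite -EFinM -EFinD; congr EFin.
  rewrite /psi /r; move: (sqr_sqrtr (ltW (k0 y))) (sk0 y).
  set s := Num.sqrt (k y) => <- s0.
  by field; rewrite gt_eqF.
have phiB : (\int[Q]_y (phi y * q0 y)%:E <= B)%E.
  apply: ge0_le_integral => //.
  - by move=> y _; rewrite lee_fin mulr_ge0.
  - by apply/measurable_EFinP; exact: measurable_funM.
  - by apply/measurable_EFinP; exact: measurable_funM.
  - move=> y _; rewrite lee_fin.
    apply: le_trans (ler_wpM2l (phi0 y) (q0q y)) _.
    rewrite /phi mulrAC ler_pdivrMr// [leRHS]mulrAC mulrC ler_pM2r//.
    rewrite -{1}[q y]sqr_sqrtr; last exact: le_trans (q0q y).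
    by rewrite expr2 ler_wpM2l ?sqrtr_ge0// lerDl ltW.
have -> : (2%:E * B + (e * K)%:E = B + (B + (e * K)%:E))%E.
  by rewrite addeA -mule2n mule_natl.
exact: leeD2r.
Qed.

(** The squared distance is total mass minus twice the affinity. The constant
    [del] accounts for the mass that [q] has in excess of the image of [p]. *)
Lemma hellinger_contraction (p h : X -> R) (q0 q k : Y -> R) (del : R) :
  P.-integrable setT (EFin \o p) -> (forall x, 0 <= p x) ->
  P.-integrable setT (EFin \o h) -> (forall x, 0 <= h x) ->
  measurable_fun setT q0 -> (forall y, 0 <= q0 y) ->
  Q.-integrable setT (EFin \o q) -> (forall y, q0 y <= q y) ->
  Q.-integrable setT (EFin \o k) -> (forall y, 0 < k y) ->
  pushes_density P S p q0 -> pushes_density P S h k ->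
  (\int[Q]_y (q y)%:E <= \int[P]_x (p x)%:E + del%:E)%E ->
  (\int[Q]_y ((Num.sqrt (q y) - Num.sqrt (k y)) ^+ 2)%:E <=
   \int[P]_x ((Num.sqrt (p x) - Num.sqrt (h x)) ^+ 2)%:E + del%:E)%E.
Proof.
move=> ip p0 ih h0 mq0 q00 iq q0q ik k0 pq hk qp.
have mp : measurable_fun setT p by exact/measurable_EFinP/(measurable_int P).
have mh : measurable_fun setT h by exact/measurable_EFinP/(measurable_int P).
have mq : measurable_fun setT q by exact/measurable_EFinP/(measurable_int Q).
have mk : measurable_fun setT k by exact/measurable_EFinP/(measurable_int Q).
have q_0 y : 0 <= q y by exact: le_trans (q0q y).
have k_0 y : 0 <= k y by exact: ltW.
have AB := hellinger_affinity_le mp p0 mh h0 mq0 mq q00 q0q k0 ik pq hk.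
have EP := hellinger_sqr_expand P mp p0 mh h0.
have EQ := hellinger_sqr_expand Q mq q_0 mk k_0.
have hkE : (\int[Q]_y (k y)%:E = \int[P]_x (h x)%:E)%E.
  have := hk (cst 1) (measurable_cst _) (fun=> ler01).
  under eq_integral do rewrite /= mul1r.
  by move=> ->; apply: eq_integral => x _; rewrite /= mul1r.
have fp := integrable_fin_num measurableT ip.
have fh := integrable_fin_num measurableT ih.
have fq := integrable_fin_num measurableT iq.
rewrite hkE in EQ.
move: AB EP EQ fp fh fq qp.
set A := (\int[P]_x (_ * _)%:E)%E; set B := (\int[Q]_x (_ * _)%:E)%E.
set D := (\int[P]_x (_ ^+ 2)%:E)%E; set E := (\int[Q]_y (_ ^+ 2)%:E)%E.
have A0 : (0 <= A)%E.
  by apply: integral_ge0 => x _; rewrite lee_fin mulr_ge0// sqrtr_ge0.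
have B0 : (0 <= B)%E.
  by apply: integral_ge0 => x _; rewrite lee_fin mulr_ge0// sqrtr_ge0.
have D0 : (0 <= D)%E by apply: integral_ge0 => x _; rewrite lee_fin sqr_ge0.
have E0 : (0 <= E)%E by apply: integral_ge0 => x _; rewrite lee_fin sqr_ge0.
rewrite /=.
move: A B D E A0 B0 D0 E0 => A B D E A0 B0 D0 E0.
set p1 := (\int[P]_x (p x)%:E)%E; set h1 := (\int[P]_x (h x)%:E)%E.
set q1 := (\int[Q]_x (q x)%:E)%E.
case: p1 => [p1| |] //; case: h1 => [h1| |] //; case: q1 => [q1| |] //.
move=> + + + _ _ _.
case: A A0 => [A| |] // _; case: B B0 => [B| |] // _; case: D D0 => [D| |] // _;
  case: E E0 => [E| |] // _; rewrite ?lee_fin ?gt0_muley//=.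
rewrite -!EFinM -!EFinD => AB [EP] [EQ].
lra.
Qed.

End hellinger.

(** * The score of the image experiment *)

Lemma sqrt_linear_approx (R : rcfType) (u : R) : -1 <= u ->
  `|Num.sqrt (1 + u) - (1 + 2^-1 * u)| <= 2^-1 * u ^+ 2.
Proof.
move=> u1; set s := Num.sqrt (1 + u).
have s0 : 0 <= s by exact: sqrtr_ge0.
have s2 : s ^+ 2 = 1 + u by rewrite sqr_sqrtr//; lra.
(* In terms of [s] the error is exactly [- (s - 1) ^ 2 / 2]. *)
have -> : u = s ^+ 2 - 1 by rewrite s2; ring.
have -> : s - (1 + 2^-1 * (s ^+ 2 - 1)) = - (2^-1 * (s - 1) ^+ 2) by field.
rewrite normrN ger0_norm; last by rewrite mulr_ge0// sqr_ge0.
have -> : (s ^+ 2 - 1) ^+ 2 = (s - 1) ^+ 2 * (s + 1) ^+ 2 by ring.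
rewrite ler_pM2l//.
by rewrite ler_peMr ?sqr_ge0// expr_ge1//; lra.
Qed.

Section score_remainder.
Context d d' (X : measurableType d) (Y : measurableType d') (R : realType).
Variables (P : probability X R) (S : {mfun X >-> Y}).
Local Notation Q := (distribution P S).

(** The roots [sqrt p] and [sqrt q] are compared with the roots of [1 + t
    Delta'] and [1 + t g']. On [X] the difference splits into the DQM
    remainder, a Taylor error and [t (Delta - Delta') / 2]; on [Y] into the
    Hellinger term, a Taylor error and [t (g' - g) / 2]. The factors [3] come
    from the square of a sum of three terms. The bound on [t] keeps the
    comparison densities positive. *)
Lemma score_remainder_le (Delta Delta' : X -> R) (g g' : Y -> R)
    (p : X -> R) (q0 q : Y -> R) (t M e del rho : R) :
  P.-integrable setT (EFin \o Delta) ->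
  is_cond_expectation P S Delta g ->
  measurable_fun setT Delta' -> (forall x, `|Delta' x| <= M) ->
  (\int[P]_x ((Delta x - Delta' x) ^+ 2)%:E <= e%:E)%E ->
  is_cond_expectation P S Delta' g' -> (forall y, `|g' y| <= M) ->
  P.-integrable setT (EFin \o p) -> (forall x, 0 <= p x) ->
  measurable_fun setT q0 -> (forall y, 0 <= q0 y) ->
  Q.-integrable setT (EFin \o q) -> (forall y, q0 y <= q y) ->
  pushes_density P S p q0 ->
  (\int[Q]_y (q y)%:E <= \int[P]_x (p x)%:E + del%:E)%E ->
  (\int[P]_x ((Num.sqrt (p x) - (1 + 2^-1 * t * Delta x)) ^+ 2)%:E
    <= rho%:E)%E ->
  `|t| * M <= 2^-1 ->
  (\int[Q]_y ((Num.sqrt (q y) - (1 + 2^-1 * t * g y)) ^+ 2)%:E <=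
    (3 * del + 9 * rho + 3 * (t ^+ 2 * e) + 3 * (t ^+ 2 * M ^+ 2) ^+ 2)%:E)%E.
Proof.
move=> iD Dg mD' D'M De D'g' g'M ip p0 mq0 q00 iq q0q pq qp prho tM.
have mD : measurable_fun setT Delta.
  exact/measurable_EFinP/(measurable_int P).
have mp : measurable_fun setT p by exact/measurable_EFinP/(measurable_int P).
have mq : measurable_fun setT q by exact/measurable_EFinP/(measurable_int Q).
have mg := cond_expectation_measurable Dg.
have mg' := cond_expectation_measurable D'g'.
have iD' : P.-integrable setT (EFin \o Delta').
  apply: measurable_bounded_integrable => //.
    by rewrite ltey_eq fin_num_measure.
  apply/bounded_funE; exists `|M| => // x.
  by apply: le_trans (ler_norm M); exact: D'M.
pose h x := 1 + t * Delta' x; pose k y := 1 + t * g' y.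
have small (a : R) : `|a| <= M -> `|t * a| <= 2^-1.
  by move=> aM; apply: le_trans tM; rewrite normrM ler_wpM2l.
have pos (a : R) : `|a| <= M -> 0 < 1 + t * a.
  by move=> /small; rewrite ler_norml => /andP[+ _]; lra.
have approx (a : R) : `|a| <= M ->
    `|Num.sqrt (1 + t * a) - (1 + 2^-1 * t * a)| <= 2^-1 * (t ^+ 2 * M ^+ 2).
  move=> aM; rewrite -mulrA; apply: le_trans (sqrt_linear_approx _) _.
    by have := pos _ aM; lra.
  rewrite exprMn ler_wpM2l// ler_wpM2l ?sqr_ge0//.
  by rewrite -[a ^+ 2]real_normK ?num_real// lerXn2r ?nnegrE// (le_trans _ aM).
have hk : is_cond_expectation P S h k by exact: is_cond_expectation_affine.
have mh : measurable_fun setT h.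
  by apply: measurable_funD => //; exact: measurable_funM.
have ih : P.-integrable setT (EFin \o h).
  exact: (integrableD _ (finite_measure_integrable_cst P 1 measurableT)
    (integrableZl _ t iD')).
have h0 x : 0 <= h x by rewrite ltW// pos.
have k0 y : 0 < k y by rewrite pos.
have ik : Q.-integrable setT (EFin \o k) by case: hk.
have mk : measurable_fun setT k by exact/measurable_EFinP/(measurable_int Q).
have hpk : pushes_density P S h k.
  by apply: cond_expectation_pushes_density => // y; exact: ltW.
have scale d0 (T : measurableType d0) (mu : probability T R) (f : T -> R) :
    measurable_fun setT f -> (\int[mu]_x (f x ^+ 2)%:E <= e%:E)%E ->
    (\int[mu]_x ((2^-1 * t * f x) ^+ 2)%:E <= (4^-1 * (t ^+ 2 * e))%:E)%E.
  move=> mf fe.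
  rewrite (eq_integral (fun x => (4^-1 * t ^+ 2)%:E * (f x ^+ 2)%:E)%E);
    last first.
    by move=> x _; rewrite -EFinM; congr EFin; field.
  have f20 x : setT x -> (0 <= (f x ^+ 2)%:E)%E.
    by move=> _; rewrite lee_fin sqr_ge0.
  have c0 : 0 <= 4^-1 * t ^+ 2 by rewrite mulr_ge0// sqr_ge0.
  rewrite ge0_integralZl_EFin//; last first.
    by apply/measurable_EFinP; exact: measurable_funX.
  have -> : 4^-1 * (t ^+ 2 * e) = (4^-1 * t ^+ 2) * e by ring.
  by rewrite [leRHS]EFinM lee_wpmul2l// lee_fin.
have onX : (\int[P]_x ((Num.sqrt (p x) - Num.sqrt (h x)) ^+ 2)%:E <=
    (3 * (rho + (2^-1 * (t ^+ 2 * M ^+ 2)) ^+ 2 + 4^-1 * (t ^+ 2 * e)))%:E)%E.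
  apply: (@ge0_integral_sqr_add3 _ _ _ P _
    (fun x => Num.sqrt (p x) - (1 + 2^-1 * t * Delta x))
    (fun x => - (Num.sqrt (h x) - (1 + 2^-1 * t * Delta' x)))
    (fun x => 2^-1 * t * (Delta x - Delta' x))) => //.
  - by apply: measurable_funB; exact: measurable_fun_sqrt.
  - apply: measurable_funB; first exact: measurable_fun_sqrt.
    by apply: measurable_funD => //; exact: measurable_funM.
  - by apply: measurable_funM => //; exact: measurable_funB.
  - by move=> x; ring.
  - by move=> x; rewrite normrN; exact: approx.
  - by apply: scale => //; exact: measurable_funB.
have onQ := hellinger_contraction ip p0 ih h0 mq0 q00 iq q0q ik k0 pq hpk qp.
have gg' : (\int[Q]_y ((g' y - g y) ^+ 2)%:E <= e%:E)%E.
  apply: (le_trans _ De).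
  have iDD' : P.-integrable setT (fun x => ((Delta x - Delta' x) ^+ 2)%:E).
    apply: ge0_integrable_fin => [|x|].
    - by apply: measurable_funX; exact: measurable_funB.
    - exact: sqr_ge0.
    - by apply: le_lt_trans De _; rewrite ltry.
  rewrite (eq_integral (fun y => ((g \- g') y ^+ 2)%:E)); last first.
    by move=> y _ /=; rewrite -sqrrN opprB.
  apply: (cond_expectation_contraction _ iDD').
    exact: (integrableB _ iD iD').
  exact: is_cond_expectationB.
have {}onQ := le_trans onQ (leeD2r del%:E onX).
apply: (@le_trans _ _ (3 * ((3 * (rho + (2^-1 * (t ^+ 2 * M ^+ 2)) ^+ 2
   + 4^-1 * (t ^+ 2 * e)) + del) + (2^-1 * (t ^+ 2 * M ^+ 2)) ^+ 2
   + 4^-1 * (t ^+ 2 * e)))%:E); last by rewrite lee_fin; lra.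
apply: (@ge0_integral_sqr_add3 _ _ _ Q _
    (fun y => Num.sqrt (q y) - Num.sqrt (k y))
    (fun y => Num.sqrt (k y) - (1 + 2^-1 * t * g' y))
    (fun y => 2^-1 * t * (g' y - g y))) => //.
- apply: measurable_funB; first exact: measurable_fun_sqrt.
  by apply: measurable_funD => //; exact: measurable_funM.
- by apply: measurable_funB; exact: measurable_fun_sqrt.
- by apply: measurable_funM => //; exact: measurable_funB.
- by move=> y; ring.
- by move=> y; exact: approx.
- by apply: scale => //; exact: measurable_funB.
Qed.

End score_remainder.

(** The density [q] is that of the image of [p], plus the density of the
    absolutely continuous part of the image of [perp]. *)
Lemma pushforward_lebesgue_decomposition d d' (X : measurableType d)
    (Y : measurableType d') (R : realType) (P Pt : probability X R)
    (S : {mfun X >-> Y}) (perp : {measure set X -> \bar R}) (p : X -> R) :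
  lebesgue_decomposition Pt P perp p ->
  exists (perp' : {measure set Y -> \bar R}) (q : Y -> R),
    [/\ lebesgue_decomposition (distribution Pt S) (distribution P S) perp' q,
        (perp' setT <= perp setT)%E,
        (distribution P S).-integrable setT (EFin \o q),
        (\int[distribution P S]_y (q y)%:E
           <= \int[P]_x (p x)%:E + (fine (perp setT))%:E)%E &
        exists q0 : Y -> R, [/\ measurable_fun setT q0, forall y, 0 <= q0 y,
          forall y, q0 y <= q y & pushes_density P S p q0]].
Proof.
move=> Pdec; have [pT ip] := lebesgue_decomposition_probability Pdec.
case: Pdec => [_ mp p0 PtE].
have ip0 : (0 <= \int[P]_x (p x)%:E)%E.
  by apply: integral_ge0 => x _; rewrite lee_fin.
have perpoo : (perp setT < +oo)%E.
  by apply: (@le_lt_trans _ _ 1%E); rewrite ?ltry// -pT leeDl.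
have [q0 [mq0 q00 iq0 pq0]] := pushes_density_exists S p0 ip.
pose pushed : {measure set Y -> \bar R} := pushforward perp S.
pose nu := pushed (measurable_funPT S).
have nuoo : (nu setT < +oo)%E by rewrite /nu/= /pushforward preimage_setT.
have [perp' [q1 [[sing mq1 q10 nuE] iq1 perp'nu]]] :=
  lebesgue_decomposition_exists (distribution P S) nuoo.
have mq : measurable_fun setT (q0 \+ q1) by exact: measurable_funD.
have QtE A : measurable A -> (distribution Pt S A =
    perp' A + \int[distribution P S]_(y in A) ((q0 \+ q1) y)%:E)%E.
  move=> mA.
  have mSA : measurable (S @^-1` A).
    by rewrite -[X in measurable X]setTI; exact: measurable_funP.
  have -> : distribution Pt S A = Pt (S @^-1` A) by [].
  rewrite PtE//.
  have -> : (perp (S @^-1` A) =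
      perp' A + \int[distribution P S]_(y in A) (q1 y)%:E)%E by rewrite -nuE.
  under [in RHS]eq_integral do rewrite EFinD.
  rewrite ge0_integralD//; last 4 first.
  - by move=> y _; rewrite lee_fin.
  - by apply/measurable_EFinP; exact: measurable_funTS.
  - by move=> y _; rewrite lee_fin.
  - by apply/measurable_EFinP; exact: measurable_funTS.
  rewrite -addeA; congr (_ + _)%E; rewrite addeC; congr (_ + _)%E.
  rewrite integral_indic_mul [RHS]integral_indic_mul.
  by rewrite (pq0 _ (measurable_indic mA) (fun=> _)).
have iq : (distribution P S).-integrable setT (EFin \o (q0 \+ q1)).
  exact: (integrableD _ iq0 iq1).
exists perp', (q0 \+ q1); split => //.
- by split => // y; rewrite addr_ge0.
- rewrite fineK; last by rewrite ge0_fin_numE.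
  have Q1 : (distribution Pt S setT = 1)%E by exact: probability_setT.
  by rewrite [leRHS]addeC pT -Q1 QtE// leeDr.
- by exists q0; split => // y; rewrite lerDl.
Qed.

Lemma o_squareP (R : realType) (F : filter_on R) (f : R -> R) :
  o_square F f <->
  forall e, 0 < e -> \forall t \near F, `|f t| <= e * t ^+ 2.
Proof.
split=> [/eqoP fo e e0|fo].
  by apply: filterS (fo e e0) => t; rewrite [X in _ * X]ger0_norm ?sqr_ge0.
apply/eqoP => e e0; apply: filterS (fo e e0) => t.
by rewrite [X in _ -> _ <= _ * X]ger0_norm ?sqr_ge0.
Qed.

Lemma dqm_at_pushforward d d' (X : measurableType d) (Y : measurableType d')
    (R : realType) (Theta : set R) (P : R -> probability X R)
    (S : {mfun X >-> Y}) (theta : R) (Delta : X -> R) (g : Y -> R) :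
  dqm_at Theta P theta Delta ->
  is_cond_expectation (P theta) S Delta g ->
  dqm_at Theta (fun theta => distribution (P theta) S) theta g.
Proof.
move=> [perp [p [PE perpo D2 ro]]] Dg.
have iD2 := Lfun2_integrable_sqr D2.
have iD : (P theta).-integrable setT (EFin \o Delta).
  by apply/Lfun1_integrable; apply: Lfun_subset12 => //; exact: fin_num_measure.
have mD : measurable_fun setT Delta.
  exact/measurable_EFinP/(measurable_int (P theta)).
have mg := cond_expectation_measurable Dg.
pose spec t (u : {measure set Y -> \bar R} * (Y -> R)) := Theta (theta + t) ->
  [/\ lebesgue_decomposition (distribution (P (theta + t)) S)
        (distribution (P theta) S) u.1 u.2,
      (u.1 setT <= perp t setT)%E,
      (distribution (P theta) S).-integrable setT (EFin \o u.2),
      (\int[distribution (P theta) S]_y (u.2 y)%:E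
         <= \int[P theta]_x (p t x)%:E + (fine (perp t setT))%:E)%E &
      exists q0 : Y -> R, [/\ measurable_fun setT q0, forall y, 0 <= q0 y,
        forall y, q0 y <= u.2 y & pushes_density (P theta) S (p t) q0]].
have /choice[u uP] : forall t, exists u, spec t u.
  move=> t; have [Tt|nTt] := pselect (Theta (theta + t)).
    have [perp' [q H]] := pushforward_lebesgue_decomposition S (PE t Tt).
    by exists (perp', q).
  by exists ((mzero : {measure set Y -> \bar R}), cst 0).
have pfacts t : Theta (theta + t) ->
  [/\ (P theta).-integrable setT (EFin \o p t),
    (perp t setT \is a fin_num) & (\int[P theta]_x (p t x)%:E <= 1)%E].
  move=> /PE Pdec; have [pT ip] := lebesgue_decomposition_probability Pdec.
  case: Pdec => [_ _ p0 _].
  have ip0 : (0 <= \int[P theta]_x (p t x)%:E)%E.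
    by apply: integral_ge0 => x _; rewrite lee_fin.
  split => //; last by rewrite -pT leeDr.
  by rewrite ge0_fin_numE// (@le_lt_trans _ _ 1%E) ?ltry// -pT leeDl.
have inTheta : \forall t \near increments_to0 Theta theta, Theta (theta + t).
  exact: withinT.
exists (fun t => (u t).1), (fun t => (u t).2); split.
- by move=> t /uP[].
- apply/o_squareP => e e0.
  move/o_squareP : perpo => /(_ e e0); apply: filterS2 inTheta => t Tt.
  apply: le_trans; have [_ le _ _ _] := uP t Tt.
  have [_ fin _] := pfacts t Tt.
  rewrite !ger0_norm ?fine_ge0// fine_le//.
  by rewrite ge0_fin_numE// (le_lt_trans le)// ltey_eq fin.
- apply: Lfun2_of_sqr_integral => //.
  apply: le_lt_trans (cond_expectation_contraction iD iD2 Dg) _.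
  exact: (integrable_lty measurableT iD2).
(* The remainder bound is [3 + 9 + 3 + 3] times [e' * t ^ 2]. *)
- apply/o_squareP => e e0; pose e' := e / 18.
  have e'0 : 0 < e' by rewrite divr_gt0.
  have [M [D' [M0 mD' D'M De]]] := sqr_truncation mD iD2 e'0.
  have [g' D'g' g'M] := bounded_cond_expectation_exists (P theta) S M0 mD' D'M.
  have near_small (a : R) : 0 < a ->
      \forall t \near increments_to0 Theta theta, `|t| <= a.
    move=> a0.
    suff : \forall t \near (0 : R), Theta (theta + t) -> `|t| <= a by [].
    by apply: filterS (nbhs0_le a0).
  have M1 : 0 < M + 1 by rewrite ltr_wpDl.
  (* The second bound gives [t ^ 2 * M ^ 4 <= e'], since [t ^ 2 <= |t|]. *)
  have a0 : 0 < 2^-1 / (M + 1) by rewrite divr_gt0.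
  have b0 : 0 < e' / (M + 1) ^+ 4 by rewrite divr_gt0// exprn_gt0.
  move/o_squareP : perpo => /(_ e' e'0); move/o_squareP : ro => /(_ e' e'0).
  move=> ron perpon.
  near=> t.
  have Tt : Theta (theta + t) by near: t.
  have ta : `|t| <= 2^-1 / (M + 1) by near: t; exact: near_small.
  have tb : `|t| <= e' / (M + 1) ^+ 4 by near: t; exact: near_small.
  have rhot :
      `|\int[P theta]_x (Num.sqrt (p t x) - (1 + 2^-1 * t * Delta x)) ^+ 2|
      <= e' * t ^+ 2 by near: t.
  have delt : `|fine (perp t setT)| <= e' * t ^+ 2 by near: t.
  have [_ _ iq qp [q0 [mq0 q00 q0q pq]]] := uP t Tt.
  have [ip _ p1] := pfacts t Tt.
  have [_ mp p0 _] := PE t Tt.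
  set rho := Rintegral _ _ _ in rhot.
  (* The real-valued integral is meaningful: [sqrt p], [1] and the score are in
     L2. *)
  have rhoE : (\int[P theta]_x
      ((Num.sqrt (p t x) - (1 + 2^-1 * t * Delta x)) ^+ 2)%:E <= rho%:E)%E.
    have msp := measurable_fun_sqrt mp.
    have mr : measurable_fun setT
        (fun x => Num.sqrt (p t x) - (1 + 2^-1 * t * Delta x)).
      apply: measurable_funB => //; apply: measurable_funD => //.
      exact: measurable_funM.
    rewrite /rho /Rintegral fineK// ge0_fin_numE; last first.
      by apply: integral_ge0 => x _; rewrite lee_fin sqr_ge0.
    have psq : (\int[P theta]_x (Num.sqrt (p t x) ^+ 2)%:E <= 1%:E)%E.
      rewrite (eq_integral (fun x => (p t x)%:E))// => x _.
      by rewrite sqr_sqrtr.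
    have ic := integrableZl measurableT ((2^-1 * t) ^+ 2) iD2.
    have cE : (\int[P theta]_x ((- (2^-1 * t * Delta x)) ^+ 2)%:E <=
        (fine (\int[P theta]_x
          (((2^-1 * t) ^+ 2)%:E * (Delta x ^+ 2)%:E)%E))%:E)%E.
      rewrite fineK; last exact: integrable_fin_num ic.
      rewrite le_eqVlt; apply/orP; left; apply/eqP; apply: eq_integral => x _.
      by rewrite -EFinM sqrrN exprMn.
    have N1 (x : X) : `|-1 : R| <= 1 by rewrite normrN1.
    apply: le_lt_trans (ge0_integral_sqr_add3 mr msp _ _ N1 psq cE) _.
    - by apply: measurable_funN; exact: measurable_funM.
    - by move=> x; ring.
    - by rewrite ltry.
  have tM : `|t| * M <= 2^-1.
    move: ta; rewrite ler_pdivlMr//; apply: le_trans.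
    by rewrite ler_wpM2l// lerDl.
  have := score_remainder_le iD Dg mD' D'M De D'g' g'M ip p0 mq0 q00 iq q0q pq
    qp rhoE tM.
  set I := (\int[_]_y _)%E => IE.
  have I0 : (0 <= I)%E by apply: integral_ge0 => y _; rewrite lee_fin sqr_ge0.
  have Ifin : I \is a fin_num.
    by rewrite ge0_fin_numE//; apply: le_lt_trans IE _; rewrite ltry.
  rewrite ger0_norm; last exact: fine_ge0.
  apply: (@le_trans _ _ (3 * fine (perp t setT) + 9 * rho + 3 * (t ^+ 2 * e') +
     3 * (t ^+ 2 * M ^+ 2) ^+ 2)).
    by rewrite -lee_fin /Rintegral fineK.
  have M4 : (t ^+ 2 * M ^+ 2) ^+ 2 <= e' * t ^+ 2.
    have t1 : `|t| <= 1.
      apply: le_trans ta _; rewrite ler_pdivrMr// mul1r; lra.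
    have t2 : t ^+ 2 <= `|t|.
      by rewrite -real_normK ?num_real// expr2 ler_piMl.
    have MM : M ^+ 4 <= (M + 1) ^+ 4.
      by rewrite lerXn2r ?nnegrE ?(ltW M1)// lerDl.
    have : `|t| * (M + 1) ^+ 4 <= e' by rewrite -ler_pdivlMr// exprn_gt0.
    have -> : (t ^+ 2 * M ^+ 2) ^+ 2 = (t ^+ 2 * M ^+ 4) * t ^+ 2 by ring.
    move=> te; rewrite ler_wpM2r ?sqr_ge0// (le_trans _ te)//.
    by rewrite ler_pM ?sqr_ge0// exprn_ge0.
  have := le_trans (ler_norm _) rhot; have := le_trans (ler_norm _) delt.
  have -> : e = 18 * e' by rewrite /e'; field.
  lra.
Unshelve. all: by end_near. Qed.

Theorem theorem7 (R : realType) (d d' : measure_display)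
    (X : measurableType d) (Y : measurableType d') (Theta : set R)
    (P : R -> probability X R) (Delta : R -> X -> R) (S : {mfun X >-> Y}) :
  let Q : R -> probability Y R := fun theta => distribution (P theta) S in
  dqm Theta P Delta ->
  (forall theta, Theta theta ->
     exists g : Y -> R, is_cond_expectation (P theta) S (Delta theta) g) /\
  (forall Deltat : R -> Y -> R,
     (forall theta, Theta theta ->
        is_cond_expectation (P theta) S (Delta theta) (Deltat theta)) ->
     dqm Theta Q Deltat /\
     (forall theta, Theta theta ->
        (fisher_information (P theta) (Delta theta)
           = fisher_information (Q theta) (Deltat theta) <->
         {ae P theta, forall x, Delta theta x = Deltat theta (S x)}))).
Proof.
move=> Q dP.
have D2 theta : Theta theta -> Delta theta \in Lfun (P theta) 2%:E.
  by move=> /dP[perp [p []]].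
have iD theta : Theta theta -> (P theta).-integrable setT (EFin \o Delta theta).
  move=> /D2 H; apply/Lfun1_integrable.
  by apply: Lfun_subset12 => //; exact: fin_num_measure.
split=> [theta /iD|Deltat Dt]; first exact: cond_expectation_exists.
split=> [theta Tt|theta Tt].
  by apply: dqm_at_pushforward (dP _ Tt) (Dt _ Tt).
apply: fisher_information_preserved (iD _ Tt) _ (Dt _ Tt).
exact: Lfun2_integrable_sqr (D2 _ Tt).
Qed.
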